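(* Let $C\subseteq\mathbb{R}^2$ be a pointed convex cone and let $G$ be the group of integer unimodular matrices $A\in\mathrm{GL}(2,\mathbb{Z})$ satisfying $AC=C$ and $A(C\cap\mathbb{Z}^2)=C\cap\mathbb{Z}^2$. Then $G$ is one of the following: (1) the trivial group; (2) a group isomorphic to $\mathbb{Z}_2$, generated by one matrix switching the two extreme rays of $C$; (3) a group isomorphic to $\mathbb{Z}$, generated by one matrix fixing each extreme ray of $C$; (4) an infinite dihedral group, generated by two matrices, one switching the extreme rays and one fixing each extreme ray.
   Context: $\mathrm{GL}(2,\mathbb{Z})$ is the group of integer $2\times2$ matrices with determinant $\pm1$. A matrix fixes an extreme ray $[u]=\{cu:c>0\}$ if it maps $[u]$ onto itself, and switches the extreme rays $[u_1],[u_2]$ if it maps $[u_1]$ onto $[u_2]$ and $[u_2]$ onto $[u_1]$.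
   Formalization: C is assumed to have nonempty interior and pointed closure, and its extreme rays are those of its closure; otherwise the claim can fail, e.g. C={0} gives G=GL(2,Z), and a rational ray gives an infinite dihedral G with only one extreme ray. *)

(* Defs.v *)
From HB Require Import structures.
From mathcomp Require Import all_boot all_order all_algebra.
From mathcomp Require Import all_classical all_reals all_analysis.

Set Implicit Arguments.
Unset Strict Implicit.
Unset Printing Implicit Defensive.

Import Order.TTheory GRing.Theory Num.Theory.
Import numFieldNormedType.Exports.

Local Open Scope classical_set_scope.
Local Open Scope ring_scope.

Section Cones.
Variable R : realType.
Implicit Types (C K : set 'cV[R]_2) (u v x y : 'cV[R]_2) (A : 'M[int]_2).

Definition convex_cone C : Prop :=
  [/\ C 0,
      forall x y, C x -> C y -> C (x + y)
    & forall (a : R) x, 0 <= a -> C x -> C (a *: x)].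

Definition pointed_cone C : Prop := forall x, C x -> C (- x) -> x = 0.

Definition full_dimensional C : Prop := interior C !=set0.

(* [u] = {c u : c > 0} *)
Definition ray u : set 'cV[R]_2 := [set x | exists2 c : R, 0 < c & x = c *: u].

(* [u] together with the origin is a one-dimensional face of K *)
Definition extreme_ray K u : Prop :=
  [/\ K u, u != 0
    & forall x y, K x -> K y -> ray u (x + y) ->
        (x = 0 \/ ray u x) /\ (y = 0 \/ ray u y)].

Definition has_extreme_rays K u1 u2 : Prop :=
  [/\ extreme_ray K u1, extreme_ray K u2, ray u1 <> ray u2
    & forall u, extreme_ray K u -> ray u = ray u1 \/ ray u = ray u2].

Definition integer_points : set 'cV[R]_2 :=
  range (fun z : 'cV[int]_2 => map_mx intr z).

Definition act A x : 'cV[R]_2 := map_mx intr A *m x.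

Definition fixes_ray A u : Prop := act A @` ray u = ray u.

Definition switches_rays A u1 u2 : Prop :=
  act A @` ray u1 = ray u2 /\ act A @` ray u2 = ray u1.

End Cones.

Definition GL2Z : set 'M[int]_2 := [set A | \det A = 1 \/ \det A = -1].

Definition cone_group (R : realType) (C : set 'cV[R]_2) : set 'M[int]_2 :=
  [set A | [/\ GL2Z A,
               act A @` C = C
             & act A @` (C `&` @integer_points R) = C `&` @integer_points R]].

Definition subgroup_GL2Z (H : set 'M[int]_2) : Prop :=
  [/\ H `<=` GL2Z, H 1%:M,
      forall A B, H A -> H B -> H (A *m B)
    & forall A, H A -> H (invmx A)].

Definition generated (S : set 'M[int]_2) : set 'M[int]_2 :=
  [set A | forall H, subgroup_GL2Z H -> S `<=` H -> H A].

(* The group G, under matrix multiplication, is isomorphic to the group with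
   carrier T and law op. *)
Definition isomorphic_to (G : set 'M[int]_2) (T : Type) (op : T -> T -> T) :
    Prop :=
  exists phi : T -> 'M[int]_2,
    [/\ injective phi, range phi = G
      & forall s t, phi (op s t) = phi s *m phi t].

(* The infinite dihedral group, as the semidirect product of Z by Z/2 acting
   by inversion: (m, b) stands for r^m s^b with s^2 = 1 and s r s = r^-1. *)
Definition dihedral_mul (x y : int * bool) : int * bool :=
  (x.1 + (-1) ^+ x.2 * y.1, x.2 (+) y.2).

Lemma dihedral_mulA : associative dihedral_mul.
Proof.
move=> [m b] [n c] [p d]; rewrite /dihedral_mul /= addbA; congr pair.
by rewrite signr_addb mulrDr addrA mulrA.
Qed.

Lemma dihedral_mul1 : left_id (0, false) dihedral_mul.
Proof. by move=> [m b]; rewrite /dihedral_mul /= add0r expr0 mul1r. Qed.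

Lemma dihedral_mulV :
  left_inverse (0, false)
    (fun x : int * bool => (- ((-1) ^+ x.2 * x.1), x.2)) dihedral_mul.
Proof. by move=> [m b]; rewrite /dihedral_mul /= addNr addbb. Qed.

(* Main.v *)
Require Import Defs.
From HB Require Import structures.
From mathcomp Require Import all_boot all_order all_algebra.
From mathcomp Require Import all_classical all_reals all_analysis.
From mathcomp Require Import ring lra.

Set Implicit Arguments.
Unset Strict Implicit.
Unset Printing Implicit Defensive.

Import Order.TTheory GRing.Theory Num.Theory.
Import numFieldNormedType.Exports.

(* The closure of C is a wedge spanned by two independent vectors u, v, and G
   permutes its two extreme rays.  If A fixes both, then A u = a u, A v = b v
   with a, b > 0, and a b = det A forces b = 1/a; as a + 1/a is the integer
   trace, the possible a form a discrete subgroup of the positive reals, and A is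
   determined by a, so these elements form a trivial or infinite cyclic group.
   If A switches the rays, then A u = a v, A v = b u and - a b = det A forces
   b = 1/a, so A is an involution, and it inverts every element fixing the
   rays. *)

Local Open Scope classical_set_scope.
Local Open Scope ring_scope.

(** * Plane vectors, determinants and the action of integer matrices *)

Section PlaneLinearAlgebra.
Variable R : realType.
Implicit Types (u v x y : 'cV[R]_2) (A B : 'M[int]_2).

(** The determinant of the matrix with columns [x] and [y]; its nonvanishing serves throughout as
    linear independence. *)
Definition cross x y : R := x 0 0 * y 1 0 - x 1 0 * y 0 0.

Lemma col2P x y : x 0 0 = y 0 0 -> x 1 0 = y 1 0 -> x = y.
Proof.
move=> h0 h1; apply/matrixP => i j; rewrite (ord1 j).
have [->|->] // : i = 0 \/ i = 1.
by case: i => [[|[|//]] ?]; [left|right]; apply/val_inj.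
Qed.

Lemma actE A x i :
  act A x i 0 = (A i 0)%:~R * x 0 0 + (A i 1)%:~R * x 1 0.
Proof.
rewrite /act mxE !big_ord_recl big_ord0 !mxE addr0.
by rewrite (_ : lift ord0 ord0 = 1) //; apply/val_inj.
Qed.

Lemma det2 A : \det A = A 0 0 * A 1 1 - A 0 1 * A 1 0.
Proof.
rewrite (expand_det_row _ 0) !big_ord_recl big_ord0 /cofactor !det_mx11 !mxE /=.
have -> : lift (0 : 'I_2) (0 : 'I_1) = 1 by apply/val_inj.
have -> : lift (1 : 'I_2) (0 : 'I_1) = 0 by apply/val_inj.
by rewrite expr0 expr1; ring.
Qed.

Lemma crossC x y : cross y x = - cross x y.
Proof. by rewrite /cross; ring. Qed.

Lemma crossxx x : cross x x = 0.
Proof. by rewrite /cross; ring. Qed.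

Lemma crossDl x y z : cross (x + y) z = cross x z + cross y z.
Proof. by rewrite /cross !mxE; ring. Qed.

Lemma crossZl a x y : cross (a *: x) y = a * cross x y.
Proof. by rewrite /cross !mxE; ring. Qed.

Lemma crossDr x y z : cross z (x + y) = cross z x + cross z y.
Proof. by rewrite /cross !mxE; ring. Qed.

Lemma crossZr a x y : cross x (a *: y) = a * cross x y.
Proof. by rewrite /cross !mxE; ring. Qed.

(** Cramer's rule. *)
Lemma cross_basis u v x : cross u v != 0 ->
  x = (cross x v / cross u v) *: u + (cross u x / cross u v) *: v.
Proof.
by rewrite /cross => h; apply: col2P; rewrite !mxE; field.
Qed.

Lemma act_cross A x y :
  cross (act A x) (act A y) = (\det A)%:~R * cross x y.
Proof. by rewrite /cross !actE det2 rmorphB !rmorphM /=; ring. Qed.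

(** Linear term in t of det(1 + tA). It reads the trace off any real basis, in particular off a
    basis of eigenvectors. *)
Lemma act_cross_trace A x y :
  cross (act A x) y + cross x (act A y) = (\tr A)%:~R * cross x y.
Proof.
have -> : \tr A = A 0 0 + A 1 1.
  rewrite /mxtrace !big_ord_recl big_ord0 addr0.
  by congr (_ + A _ _); apply/val_inj.
by rewrite /cross !actE rmorphD /=; ring.
Qed.

Lemma actD A x y : act A (x + y) = act A x + act A y.
Proof. exact: mulmxDr. Qed.

Lemma actZ A (a : R) x : act A (a *: x) = a *: act A x.
Proof. by rewrite /act -scalemxAr. Qed.

Lemma act1 x : act 1 x = x.
Proof. by rewrite /act map_mx1 mul1mx. Qed.

Lemma actM A B x : act (A * B) x = act A (act B x).
Proof. by rewrite /act -mulmxE map_mxM mulmxA. Qed.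

(** The two actions agree on a basis, hence everywhere; the standard basis then recovers the
    entries, as integers embed injectively in [R]. *)
Lemma act_inj_basis u v A B : cross u v != 0 ->
  act A u = act B u -> act A v = act B v -> A = B.
Proof.
move=> uv hu hv.
have h x : act A x = act B x.
  by rewrite (cross_basis x uv) !actD !actZ hu hv.
apply/matrixP => i j; apply: (@intr_inj R).
pose e : 'cV[R]_2 := delta_mx j 0.
have := congr1 (fun z : 'cV[R]_2 => z i 0) (h e).
by rewrite /act -!colE !mxE.
Qed.

Lemma GL2Z_unit A : GL2Z A -> A \is a GRing.unit.
Proof. by case=> h; rewrite -[_ \is a _]/(A \in unitmx) unitmxE h. Qed.

Lemma actK A : A \is a GRing.unit -> cancel (@act R A) (act A^-1).
Proof. by move=> uA x; rewrite -actM mulVr // act1. Qed.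

Lemma actVK A : A \is a GRing.unit -> cancel (@act R A^-1) (act A).
Proof. by move=> uA x; rewrite -actM mulrV // act1. Qed.

Lemma act_continuous A : continuous (@act R A).
Proof.
move=> x.
(* As a combination of the columns of [A], the map is continuous because coordinates are. *)
have -> : @act R A = (fun y : 'cV[R]_2 =>
    y 0 0 *: (map_mx intr (col 0 A) : 'cV[R]_2) +
    y 1 0 *: (map_mx intr (col 1 A) : 'cV[R]_2)).
  by apply/funext => y; apply: col2P; rewrite actE !mxE; ring.
have h (i : 'I_2) (c : 'cV[R]_2) :
    {for x, continuous (fun y : 'cV[R]_2 => y i 0 *: c)}.
  have ci : {for x, continuous (fun y : 'cV[R]_2 => y i 0)}.
    exact: coord_continuous.
  exact: (@cvgZr_tmp _ _ _ _ (nbhs_filter x) _ _ c ci).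
by apply: cvgD; [exact: (nbhs_filter x)|exact: h|exact: h].
Qed.

End PlaneLinearAlgebra.

(** * Rays, extreme rays and wedges *)

Section Rays.
Variable R : realType.
Implicit Types (u v x y : 'cV[R]_2) (A B : 'M[int]_2) (K : set 'cV[R]_2).

Lemma ray_refl u : ray u u.
Proof. by exists 1 => //; rewrite scale1r. Qed.

Lemma ray_scale u v : ray u v -> ray v = ray u.
Proof.
case=> c c0 ->; apply/seteqP; split => [x [d d0 ->]|x [d d0 ->]].
  by exists (d * c); [exact: mulr_gt0|rewrite scalerA].
by exists (d / c); [exact: divr_gt0|rewrite scalerA divfK ?gt_eqF].
Qed.

Lemma ray_eqP u v : ray u = ray v <-> ray v u.
Proof. by split=> [<-|/ray_scale//]; exact: ray_refl. Qed.

Lemma act_ray A u : act A @` ray u = ray (act A u).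
Proof.
apply/seteqP; split => [x [y [c c0 ->]] <-|x [c c0 ->]].
  by exists c => //; rewrite actZ.
by exists (c *: u); [exists c|rewrite actZ].
Qed.

(** A linear bijection preserving [K] maps faces to faces: a decomposition of [act A u] is pulled
    back by the inverse, split there, and pushed forward again. *)
Lemma act_extreme_ray K A u : A \is a GRing.unit -> act A @` K = K ->
  extreme_ray K u -> extreme_ray K (act A u).
Proof.
move=> uA AK [Ku u0 ext].
have KV x : K x -> K (act A^-1 x).
  by rewrite -{1}AK => -[y Ky <-]; rewrite actK.
split.
- by rewrite -AK; exists u.
- apply: contra_neq u0 => h.
  by rewrite -[u](actK uA) h -[RHS](actK uA) /act !mulmx0.
- move=> x y Kx Ky [c c0 xy].
  have back z : z = 0 \/ ray u z -> act A z = 0 \/ ray (act A u) (act A z).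
    move=> [->|[d d0 ->]]; first by left; rewrite /act mulmx0.
    by right; exists d => //; rewrite actZ.
  have [|hx hy] := ext _ _ (KV _ Kx) (KV _ Ky).
    by exists c => //; rewrite -actD xy actZ actK.
  by move: (back _ hx) (back _ hy); rewrite !actVK.
Qed.

Definition wedge u v : set 'cV[R]_2 :=
  [set x | exists a b : R, [/\ 0 <= a, 0 <= b & x = a *: u + b *: v]].

Lemma wedgeC u v : wedge u v = wedge v u.
Proof.
by apply/seteqP; split => x [a [b [a0 b0 ->]]]; exists b, a; rewrite addrC.
Qed.

Lemma wedge_extremel u v : cross u v != 0 -> extreme_ray (wedge u v) u.
Proof.
move=> uv.
have u0 : u != 0.
  by apply: contra_neq uv => ->; rewrite /cross !mxE !mul0r subrr.
split => //.
  by exists 1, 0; split; rewrite // scale1r scale0r addr0.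
move=> x y [a [b [a0 b0 ->]]] [c [d [c0 d0 ->]]] [k k0 e].
(* Pairing with [u] kills the [u]-components, so the two nonnegative coefficients of [v] sum to 0
   and both vanish. *)
have := congr1 (cross u) e.
rewrite !(crossDr, crossZr) crossxx !mulr0 !add0r -mulrDl => /eqP.
rewrite mulf_eq0 (negbTE uv) orbF paddr_eq0 // => /andP[/eqP -> /eqP ->].
have h (t : R) : 0 <= t -> t *: u + 0 *: v = 0 \/ ray u (t *: u + 0 *: v).
  rewrite scale0r addr0 le_eqVlt => /orP[/eqP <-|t0].
    by left; rewrite scale0r.
  by right; exists t.
by split; exact: h.
Qed.

Lemma wedge_has_extreme_rays u v : cross u v != 0 ->
  has_extreme_rays (wedge u v) u v.
Proof.
move=> uv.
have vu : cross v u != 0 by rewrite crossC oppr_eq0.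
split.
- exact: wedge_extremel.
- by rewrite wedgeC; exact: wedge_extremel.
- move/ray_eqP => [c c0 e]; move: uv; rewrite e crossZl crossxx mulr0.
  by rewrite eqxx.
- move=> w [[a [b [a0 b0 e]]] w0 ext].
  (* An extreme vector [w] is the sum of its components along [u] and [v], both in the wedge;
     extremality puts any nonzero component on the ray of [w]. *)
  have Ku : wedge u v (a *: u) by exists a, 0; rewrite scale0r addr0.
  have Kv : wedge u v (b *: v) by exists 0, b; rewrite scale0r add0r.
  have [] := ext _ _ Ku Kv; first by rewrite -e; exact: ray_refl.
  case=> [au0|wu] [bv0|wv].
  + by move: w0; rewrite e au0 bv0 addr0 eqxx.
  + right; rewrite -(ray_scale wv); apply/ray_scale.
    exists b => //; rewrite lt_neqAle b0 andbT; apply: contra_neq w0 => b_0.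
    by rewrite e au0 -b_0 scale0r addr0.
  + left; rewrite -(ray_scale wu); apply/ray_scale.
    exists a => //; rewrite lt_neqAle a0 andbT; apply: contra_neq w0 => a_0.
    by rewrite e bv0 -a_0 scale0r addr0.
  + left; rewrite -(ray_scale wu); apply/ray_scale.
    exists a => //; rewrite lt_neqAle a0 andbT; apply/eqP => a_0.
    move: wu => [c c0]; rewrite -a_0 scale0r => /esym/eqP.
    by rewrite scaler_eq0 (negbTE w0) gt_eqF.
Qed.

End Rays.

(** * Closed pointed plane cones are wedges *)

Section ClosedCones.
Variable R : realType.
Implicit Types (u v x y e w : 'cV[R]_2) (A : 'M[int]_2) (C K : set 'cV[R]_2).

Lemma closure_continuous (T U : topologicalType) (f : T -> U) (X : set T)
    (Y : set U) (x : T) :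
  continuous f -> (forall y : T, X y -> Y (f y)) -> closure X x -> closure Y (f x).
Proof.
move=> fc fXY clx B Bfx; have [y [Xy By]] := clx _ (fc _ _ Bfx).
by exists (f y); split => //; exact: fXY.
Qed.

Lemma addr_continuousl y : continuous (fun x => x + y).
Proof.
move=> x; apply: (@cvgD _ _ _ _ (nbhs_filter x)); first exact: cvg_id.
exact: (@cvg_cst _ _ _ _ (nbhs_filter x)).
Qed.

Lemma scaler_continuousr (a : R) : continuous (fun x => a *: x).
Proof. exact: scaler_continuous. Qed.

Lemma line_continuous x e : continuous (fun t : R => x + t *: e).
Proof.
move=> t; apply: cvgD; first exact: cvg_cst.
exact: (@cvgZr_tmp _ _ _ _ (nbhs_filter t) _ _ e cvg_id).
Qed.

Lemma closure_convex_cone C : convex_cone C -> convex_cone (closure C).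
Proof.
move=> [C0 CD CZ]; split; first exact: subset_closure.
- move=> x y clx cly.
  (* Closure is passed to one summand at a time: first with the other in [C], then with the other in
     [closure C]. *)
  have half a b : closure C a -> C b -> closure C (a + b).
    move=> cla Cb; apply: (closure_continuous (@addr_continuousl b)) cla => z Cz.
    exact: CD.
  rewrite addrC; apply: closed_closure.
  apply: closure_continuous (@addr_continuousl x) _ cly => z Cz.
  by rewrite addrC; exact: half.
- move=> a x a0; apply: closure_continuous (@scaler_continuousr a) _ => y.
  exact: CZ.
Qed.

Lemma act_closure A C : A \is a GRing.unit -> act A @` C = C ->
  act A @` closure C = closure C.
Proof.
move=> uA AC; apply/seteqP; split => [_ [x clx <-]|x clx].
  apply: closure_continuous (@act_continuous R A) _ clx => y Cy.
  by rewrite -AC; exists y.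
exists (act A^-1 x); last exact: actVK.
apply: closure_continuous (@act_continuous R _) _ clx => y.
by rewrite -{1}AC => -[z Cz <-]; rewrite actK.
Qed.

Lemma closed_has_inf_mem (X : set R) : closed X -> has_inf X -> X (inf X).
Proof.
move=> clX hX; apply: clX => B /nbhs_ballP[d /= d0 dB].
have [t Xt t_lt] := inf_adherent d0 hX.
exists t; split => //; apply: dB; rewrite /ball /= ler0_norm; first lra.
by rewrite subr_le0; apply: (ge_inf hX.2).
Qed.

Lemma interior_segment K w e : interior K w ->
  exists2 d : R, 0 < d & K (w + d *: e) /\ K (w - d *: e).
Proof.
move=> iw.
have : nbhs (w + 0 *: e) K by rewrite scale0r addr0.
move/(@line_continuous w e 0)/nbhs_ballP => [d /= d0 dK].
(* Halving keeps both parameters strictly inside the open ball of radius [d]. *)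
have d2 : 0 < d / 2 by lra.
exists (d / 2) => //; split; last rewrite -scaleNr.
  by apply: (dK (d / 2)); rewrite /ball /= sub0r normrN gtr0_norm //; lra.
by apply: (dK (- (d / 2))); rewrite /ball /= sub0r opprK gtr0_norm //; lra.
Qed.

(* [e + t *: w] spans the boundary ray met when rotating [w] towards [e]. *)
Lemma boundary_direction K w e : convex_cone K -> pointed_cone K ->
  closed K -> interior K w -> cross w e != 0 ->
  exists2 t : R, K (e + t *: w) & forall s, K (e + s *: w) -> t <= s.
Proof.
move=> [K0 KD KZ] Kp Kc iw we.
have Kw : K w by exact: (interior_subset iw).
have [d d0 [Kp1 Km1]] := interior_segment e iw.
pose X := [set t : R | K (e + t *: w)].
(* Below -1/d, adding a multiple of [w] would put e - w/d in [K]; its opposite (w - d e)/d is there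
   too, so pointedness would make [e] a multiple of [w]. *)
have lbX : has_lbound X.
  exists (- d^-1) => t Xt; rewrite leNgt; apply/negP => t_lt.
  have h1 : K (e - d^-1 *: w).
    have -> : e - d^-1 *: w = (e + t *: w) + (- d^-1 - t) *: w.
      by rewrite -addrA -scalerDl -scaleNr; congr (_ + _ *: _); ring.
    by apply: KD => //; apply: KZ => //; lra.
  have h2 : K (- (e - d^-1 *: w)).
    have -> : - (e - d^-1 *: w) = d^-1 *: (w - d *: e).
      by rewrite scalerBr scalerA mulVf ?gt_eqF // scale1r opprB.
    by apply: KZ => //; rewrite invr_ge0 ltW.
  move/(congr1 (cross w)): (Kp _ h1 h2).
  rewrite -scaleNr crossDr crossZr crossxx mulr0 addr0 => h.
  by move: we; rewrite h /cross !mxE !mulr0 subrr eqxx.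
have neX : X !=set0.
  exists d^-1; rewrite /X /=.
  have -> : e + d^-1 *: w = d^-1 *: (w + d *: e).
    by rewrite scalerDr scalerA mulVf ?gt_eqF // scale1r addrC.
  by apply: KZ => //; rewrite invr_ge0 ltW.
exists (inf X); last by move=> s Ks; apply: ge_inf.
apply: (@closed_has_inf_mem X); last by split.
apply: preimage_closed Kc => t _; exact: line_continuous.
Qed.

(** Rotating an interior vector [w] both ways, towards [e] and towards [- e], until the boundary is
    met gives the two generators. Their sum is a positive multiple of [w], so [w] lies in the wedge
    they span. *)
Lemma pointed_cone_wedge K : convex_cone K -> pointed_cone K ->
  closed K -> full_dimensional K ->
  exists u v, cross u v != 0 /\ K = wedge u v.
Proof.
move=> Kcone Kp Kc [w iw].
have [K0 KD KZ] := Kcone.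
have Kw : K w by exact: (interior_subset iw).
have w0 : w != 0.
  (* If 0 were interior, [K] would contain a small multiple of any vector together with its
     opposite. *)
  apply/eqP => w0; pose e : 'cV[R]_2 := const_mx 1.
  have [d d0 [h1 h2]] := interior_segment e iw.
  move: h1 h2; rewrite w0 add0r sub0r => h1 h2.
  have /matrixP/(_ 0 0) := Kp _ h1 h2.
  by rewrite !mxE mulr1 => d_0; move: d0; rewrite d_0 ltxx.
(* A quarter turn of [w], so that [cross w e] is the squared length of [w]. *)
pose e : 'cV[R]_2 := \col_i (if i == 0 then - w 1 0 else w 0 0).
have we : cross w e != 0.
  apply: contra_neq w0; rewrite /cross !mxE /= mulrN opprK => /eqP.
  rewrite -!expr2 paddr_eq0 ?sqr_ge0 // !sqrf_eq0 => /andP[/eqP h0 /eqP h1].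
  by apply: col2P; rewrite mxE.
have wNe : cross w (- e) != 0.
  by rewrite -scaleN1r crossZr mulN1r oppr_eq0.
have [t1 K1 min1] := boundary_direction Kcone Kp Kc iw we.
have [t2 K2 min2] := boundary_direction Kcone Kp Kc iw wNe.
set u := e + t1 *: w in K1; set v := - e + t2 *: w in K2.
have uv : u + v = (t1 + t2) *: w.
  by rewrite /u /v addrACA subrr add0r scalerDl.
have cuv : cross u v = (t1 + t2) * cross w v - cross v v.
  by rewrite -crossZl -uv crossDl addrK.
have cwv : cross w v = - cross w e.
  by rewrite /v crossDr crossZr crossxx mulr0 addr0 -scaleN1r crossZr mulN1r.
(* Otherwise -u = v - (t1 + t2) w would lie in [K] along with [u]. *)
have t12 : 0 < t1 + t2.
  rewrite ltNge; apply/negP => t_le.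
  have KNu : K (- u).
    have -> : - u = v + (- (t1 + t2)) *: w.
      by rewrite scaleNr -uv [- (u + v)]opprD addrCA [v - v]subrr addr0.
    by apply: KD => //; apply: KZ; rewrite // oppr_ge0.
  move/(congr1 (cross w)): (Kp _ K1 KNu).
  rewrite crossDr crossZr crossxx mulr0 addr0 => h.
  by move: we; rewrite h /cross !mxE !mulr0 subrr eqxx.
exists u, v; split.
  by rewrite cuv crossxx subr0 cwv mulrN oppr_eq0 mulf_neq0 // gt_eqF.
apply/seteqP; split; last first.
  by move=> x [a [b [a0 b0 ->]]]; apply: KD; apply: KZ.
have wE : w = (t1 + t2)^-1 *: u + (t1 + t2)^-1 *: v.
  by rewrite -scalerDr uv scalerA mulVf ?scale1r // gt_eqF.
have i0 : 0 <= (t1 + t2)^-1 by rewrite invr_ge0 ltW.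
move=> x Kx.
have [a [b xE]] : exists a b, x = a *: e + b *: w.
  have ew : cross e w != 0 by rewrite crossC oppr_eq0.
  by rewrite {1}(cross_basis x ew); do 2 eexists.
(* The sign of [a] tells on which side of [w] the vector [x] lies. On the side of [v], minimality of
   [t2] gives x = (-a) v + c w with c >= 0; on the side of [u], [t1] plays the same role. Then [w]
   is expanded by [wE]. *)
have [a0|a0|a0] := ltgtP a 0.
- have Na0 : 0 < - a by lra.
  have /min2 hb : K (- e + (b / - a) *: w).
    have -> : - e + (b / - a) *: w = (- a)^-1 *: x.
      rewrite xE scalerDr !scalerA [b / _]mulrC; congr (_ + _).
      by rewrite invrN mulNr mulVf ?lt_eqF // scaleN1r.
    by apply: KZ => //; rewrite invr_ge0 ltW.
  have c0 : 0 <= b - (- a) * t2.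
    by move: hb; rewrite ler_pdivlMr // subr_ge0 mulrC.
  exists ((b - (- a) * t2) / (t1 + t2)), (- a + (b - (- a) * t2) / (t1 + t2)).
  split; [exact: mulr_ge0|by rewrite addr_ge0 ?mulr_ge0 // ltW|].
  rewrite scalerDl addrCA -!scalerA -scalerDr -wE /v scalerDr scalerA xE.
  by rewrite -addrA -scalerDl scalerN scaleNr opprK; congr (_ + _ *: _); ring.
- have /min1 hb : K (e + (b / a) *: w).
    have -> : e + (b / a) *: w = a^-1 *: x.
      rewrite xE scalerDr !scalerA [b / _]mulrC; congr (_ + _).
      by rewrite mulVf ?gt_eqF // scale1r.
    by apply: KZ => //; rewrite invr_ge0 ltW.
  have c0 : 0 <= b - a * t1.
    by move: hb; rewrite ler_pdivlMr // subr_ge0 mulrC.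
  exists (a + (b - a * t1) / (t1 + t2)), ((b - a * t1) / (t1 + t2)).
  split; [by rewrite addr_ge0 ?mulr_ge0 // ltW|exact: mulr_ge0|].
  rewrite scalerDl -addrA -!scalerA -scalerDr -wE /u scalerDr scalerA xE.
  by rewrite -addrA -scalerDl; congr (_ + _ *: _); ring.
(* Here [x] is a multiple of [w], and a negative one would put [- w] in [K]. *)
- have b0 : 0 <= b.
    rewrite leNgt; apply/negP => b0; move/eqP: w0; apply; apply: Kp => //.
    have -> : - w = (- b)^-1 *: x.
      rewrite xE a0 scale0r add0r scalerA invrN mulNr mulVf ?lt_eqF //.
      by rewrite scaleN1r.
    by apply: KZ => //; rewrite invr_ge0; lra.
  exists (b / (t1 + t2)), (b / (t1 + t2)); split; rewrite ?mulr_ge0 //.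
  by rewrite -!scalerA -scalerDr -wE xE a0 scale0r add0r.
Qed.

End ClosedCones.

(** * Subgroups of GL(2,Z), and the cone group as one of them *)

Section Subgroups.
Implicit Types (A B : 'M[int]_2) (G S : set 'M[int]_2).

Lemma subgroup_unit G A : subgroup_GL2Z G -> G A -> A \is a GRing.unit.
Proof. by move=> [GL _ _ _] /GL /GL2Z_unit. Qed.

Lemma subgroupM G A B : subgroup_GL2Z G -> G A -> G B -> G (A * B).
Proof. by move=> [_ _ GM _] GA GB; rewrite -mulmxE; exact: GM. Qed.

Lemma subgroupV G A : subgroup_GL2Z G -> G A -> G A^-1.
Proof. by move=> [_ _ _ GV] /GV. Qed.

Lemma subgroupXz G A (n : int) : subgroup_GL2Z G -> G A -> G (A ^ n).
Proof.
move=> Ggrp GA; have GX k : G (A ^+ k).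
  elim: k => [|k IHk]; first by case: Ggrp.
  by rewrite exprS; exact: subgroupM.
by case: n => k; [exact: GX|rewrite NegzE -exprnN; exact: subgroupV].
Qed.

Lemma generated_eq G S : subgroup_GL2Z G -> S `<=` G ->
  (forall H, subgroup_GL2Z H -> S `<=` H -> G `<=` H) -> G = generated S.
Proof.
move=> Ggrp SG Gmin; apply/seteqP; split; last by move=> A; exact.
by move=> A GA H Hgrp SH; exact: Gmin GA.
Qed.

Lemma act_image_mul (R : realType) (X : set 'cV[R]_2) A B :
  act A @` X = X -> act B @` X = X -> act (A * B) @` X = X.
Proof.
move=> AX BX; rewrite -{2}AX -{2}BX image_comp.
by apply: eq_imagel => x _; rewrite actM.
Qed.

Lemma act_image_inv (R : realType) (X : set 'cV[R]_2) A :
  A \is a GRing.unit -> act A @` X = X -> act A^-1 @` X = X.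
Proof.
move=> uA AX; rewrite -{1}AX image_comp -[RHS]image_id.
by apply: eq_imagel => x _ /=; rewrite actK.
Qed.

Lemma cone_group_subgroup (R : realType) (C : set 'cV[R]_2) :
  subgroup_GL2Z (cone_group C).
Proof.
have act1X (X : set 'cV[R]_2) : act 1 @` X = X.
  by rewrite -[RHS]image_id; apply: eq_imagel => x _; rewrite act1.
split.
- by move=> A [].
- by split; [left; exact: det1|exact: act1X|exact: act1X].
- move=> A B [dA A1 A2] [dB B1 B2]; rewrite mulmxE; split.
  + rewrite /GL2Z /= -mulmxE det_mulmx.
    by case: dA => ->; case: dB => ->; [left|right|right|left].
  + exact: act_image_mul.
  + exact: act_image_mul.
- move=> A [dA A1 A2]; have uA := GL2Z_unit dA.
  split; [|exact: act_image_inv|exact: act_image_inv].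
  by rewrite /GL2Z /= det_inv; case: dA => ->; [left|right].
Qed.

End Subgroups.

(** * Matrices fixing or switching two independent rays *)

Section DiagonalAntidiagonal.
Variables (R : realType) (u v : 'cV[R]_2).
Hypothesis uv : cross u v != 0.
Implicit Types (A B : 'M[int]_2) (a b : R).

(** A single parameter suffices: determinant plus or minus 1 and positivity force the second factor
    to be the inverse of the first. The same holds for [antidiagonal]. *)
Definition diagonal A a := [/\ 0 < a, act A u = a *: u & act A v = a^-1 *: v].

Definition antidiagonal A a :=
  [/\ 0 < a, act A u = a *: v & act A v = a^-1 *: u].

Lemma diagonal1 : diagonal 1 1.
Proof. by split; rewrite ?invr1 ?scale1r ?act1. Qed.

Lemma diagonalM A B a b :
  diagonal A a -> diagonal B b -> diagonal (A * B) (a * b).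
Proof.
move=> [a0 Au Av] [b0 Bu Bv]; split; first exact: mulr_gt0.
  by rewrite actM Bu actZ Au scalerA mulrC.
by rewrite actM Bv actZ Av scalerA invfM mulrC.
Qed.

Lemma antidiagonalM A B a b :
  antidiagonal A a -> antidiagonal B b -> diagonal (A * B) (b / a).
Proof.
move=> [a0 Au Av] [b0 Bu Bv]; split; first exact: divr_gt0.
  by rewrite actM Bu actZ Av scalerA.
by rewrite actM Bv actZ Au scalerA invfM invrK.
Qed.

Lemma diagonal_antidiagonalM A B a b :
  diagonal A a -> antidiagonal B b -> antidiagonal (A * B) (b / a).
Proof.
move=> [a0 Au Av] [b0 Bu Bv]; split; first exact: divr_gt0.
  by rewrite actM Bu actZ Av scalerA.
by rewrite actM Bv actZ Au scalerA invfM invrK.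
Qed.

Lemma antidiagonal_diagonalM A B a b :
  antidiagonal A a -> diagonal B b -> antidiagonal (A * B) (a * b).
Proof.
move=> [a0 Au Av] [b0 Bu Bv]; split; first exact: mulr_gt0.
  by rewrite actM Bu actZ Au scalerA mulrC.
by rewrite actM Bv actZ Av scalerA invfM mulrC.
Qed.

Lemma diagonalV A a : A \is a GRing.unit -> diagonal A a -> diagonal A^-1 a^-1.
Proof.
move=> uA [a0 Au Av]; have ane : a != 0 by rewrite gt_eqF.
split; first by rewrite invr_gt0.
  by rewrite -{1}[u]scale1r -(mulVf ane) -scalerA -Au actZ actK.
by rewrite invrK -{1}[v]scale1r -{1}(mulfV ane) -scalerA -Av actZ actK.
Qed.

Lemma diagonalXz A a (n : int) :
  A \is a GRing.unit -> diagonal A a -> diagonal (A ^ n) (a ^ n).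
Proof.
move=> uA dA; have dX k : diagonal (A ^+ k) (a ^+ k).
  elim: k => [|k IHk]; first exact: diagonal1.
  by rewrite !exprS; exact: diagonalM.
case: n => k; [exact: dX|rewrite NegzE -!exprnN].
by apply: diagonalV => //; rewrite unitrX.
Qed.

Lemma diagonal_inj A B a : diagonal A a -> diagonal B a -> A = B.
Proof.
by move=> [_ Au Av] [_ Bu Bv]; apply: (act_inj_basis uv); rewrite ?Au ?Av.
Qed.

Lemma antidiagonal_inj A B a : antidiagonal A a -> antidiagonal B a -> A = B.
Proof.
by move=> [_ Au Av] [_ Bu Bv]; apply: (act_inj_basis uv); rewrite ?Au ?Av.
Qed.

Lemma diagonal_uniq A a b : diagonal A a -> diagonal A b -> a = b.
Proof.
move=> [_ Au _] [_ Au' _].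
have := congr1 (fun z => cross z v) (etrans (esym Au) Au').
by rewrite !crossZl; apply: mulIf.
Qed.

Lemma diagonal_not_antidiagonal A a b : diagonal A a -> ~ antidiagonal A b.
Proof.
move=> [a0 Au _] [_ Au' _].
have := congr1 (fun z => cross z v) (etrans (esym Au) Au').
rewrite !crossZl crossxx mulr0 => /eqP.
by rewrite mulf_eq0 (negbTE uv) gt_eqF.
Qed.

Lemma diagonal_trace A a : diagonal A a -> (\tr A)%:~R = a + a^-1.
Proof.
move=> [_ Au Av]; apply: (mulIf uv).
by rewrite -act_cross_trace Au Av crossZl crossZr mulrDl.
Qed.

(** The product is 1 or -1 up to the sign of the determinant, and positivity leaves only 1. *)
Lemma pos_pair_inverse A a b : GL2Z A -> 0 < a -> 0 < b ->
  a * b = (\det A)%:~R \/ a * b = - (\det A)%:~R -> b = a^-1.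
Proof.
move=> dA a0 b0 ab; have ab0 : 0 < a * b by exact: mulr_gt0.
suff ab1 : a * b = 1 by rewrite -[b](mulKf (lt0r_neq0 a0)) ab1 mulr1.
by move: ab0; case: ab => ->; case: dA => ->; rewrite ?mulrNz ?mulr1z; lra.
Qed.

Lemma GL2Z_diagonal A a b : GL2Z A -> 0 < a -> 0 < b ->
  act A u = a *: u -> act A v = b *: v -> diagonal A a.
Proof.
move=> dA a0 b0 Au Av; split => //; rewrite Av; congr (_ *: _).
apply: (pos_pair_inverse dA) => //; left; apply: (mulIf uv).
by rewrite -act_cross Au Av crossZl crossZr mulrA.
Qed.

Lemma GL2Z_antidiagonal A a b : GL2Z A -> 0 < a -> 0 < b ->
  act A u = a *: v -> act A v = b *: u -> antidiagonal A a.
Proof.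
move=> dA a0 b0 Au Av; split => //; rewrite Av; congr (_ *: _).
apply: (pos_pair_inverse dA) => //; right; apply: (mulIf uv).
(* Exchanging [u] and [v] reverses the sign of [cross], so here the product is minus the
   determinant. *)
by rewrite mulNr -act_cross Au Av crossZl crossZr (crossC u v); ring.
Qed.

Lemma diagonal_fixes A a : diagonal A a -> fixes_ray A u /\ fixes_ray A v.
Proof.
move=> [a0 Au Av]; rewrite /fixes_ray !act_ray Au Av.
by split; apply/ray_scale; [exists a|exists a^-1; rewrite ?invr_gt0].
Qed.

Lemma antidiagonal_switches A a : antidiagonal A a -> switches_rays A u v.
Proof.
move=> [a0 Au Av]; rewrite /switches_rays !act_ray Au Av.
by split; apply/ray_scale; [exists a|exists a^-1; rewrite ?invr_gt0].
Qed.

(* Eigenvalues exceeding 1 are ordered like the integral traces a + 1/a, so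
   there is a least one; floor division in the exponent does the rest. *)
Lemma diagonal_cyclic (G : set 'M[int]_2) : subgroup_GL2Z G ->
  (exists A a, [/\ G A, diagonal A a & a != 1]) ->
  exists B b, [/\ G B, diagonal B b, 1 < b
    & forall A a, G A -> diagonal A a -> exists n : int, A = B ^ n].
Proof.
move=> Ggrp [A0 [a0 [GA0 dA0 a0n]]].
(* Eigenvalues are real, but their traces are integers: minimizing over natural numbers makes the
   least one available. *)
pose P n := `[< exists A a, [/\ G A, diagonal A a, 1 < a & n = `|\tr A|%N] >].
(* An eigenvalue below 1 is replaced by that of the inverse matrix. *)
have exP : exists n, P n.
  have [a_gt|a_lt|/eqP] := ltgtP 1 a0; last by rewrite eq_sym (negbTE a0n).
    by exists `|\tr A0|%N; apply/asboolP; exists A0, a0.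
  exists `|\tr A0^-1|%N; apply/asboolP; exists A0^-1, a0^-1; split => //.
  - exact: subgroupV.
  - by apply: diagonalV => //; exact: subgroup_unit GA0.
  - by case: dA0 => a0p _ _; rewrite invf_gt1.
case: (ex_minnP exP) => m /asboolP[B [b [GB dB b1 mE]]] min_m.
have bmin A a : G A -> diagonal A a -> 1 < a -> b <= a.
  move=> GA dA a1; rewrite leNgt; apply/negP => ab.
  have : (m <= `|\tr A|)%N by apply: min_m; apply/asboolP; exists A, a.
  rewrite mE => h.
  have trpos C c : diagonal C c -> 1 < c -> 0 <= \tr C.
    move=> dC c1; rewrite -(ler0z R) (diagonal_trace dC).
    by have : 0 < c^-1; [rewrite invr_gt0|]; lra.
  have : (\tr B)%:~R <= (\tr A)%:~R :> R.
    by rewrite ler_int -(gez0_abs (trpos _ _ dB b1)) -(gez0_abs (trpos _ _ dA a1)).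
  rewrite (diagonal_trace dA) (diagonal_trace dB) => le.
  have a0' : a != 0 by apply/eqP; lra.
  have b0' : b != 0 by apply/eqP; lra.
  (* For 1 < a < b this difference is positive, so [A] would have a smaller trace than the minimal
     one. *)
  have e : (b + b^-1) - (a + a^-1) = (b - a) * (a * b - 1) / (a * b).
    by field; rewrite a0' b0'.
  have : 0 < (b - a) * (a * b - 1) / (a * b).
    by apply: divr_gt0; [apply: mulr_gt0|]; nra.
  lra.
exists B, b; split => // A a GA dA.
have [a_gt0 _ _] := dA; have b_gt0 : 0 < b by lra.
have uB := subgroup_unit Ggrp GB.
have lnb : 0 < ln b by rewrite ln_gt0.
(* The integer part of the logarithm of [a] to base [b]: dividing by b^n brings the eigenvalue into
   [1, b), where minimality of [b] leaves only 1. *)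
pose n := Num.floor (ln a / ln b); exists n.
have bX k : b ^ k = expR (k%:~R * ln b).
  by rewrite -powR_intmul ?ltW // /powR gt_eqF.
have /andP[nlo nhi] := floor_itv (ln a / ln b).
have dAB : diagonal (A * B ^ (- n)) (a * b ^ (- n)).
  by apply: diagonalM => //; exact: diagonalXz.
have c1 : 1 <= a * b ^ (- n).
  rewrite bX -[a in a * _]lnK // -expRD -[leLHS]expR0 ler_expR mulrNz mulNr subr_ge0.
  by rewrite -ler_pdivlMr.
have cb : a * b ^ (- n) < b.
  rewrite bX -[a in a * _]lnK // -expRD -[ltRHS]lnK // ltr_expR mulrNz mulNr.
  rewrite ltrBlDr -[X in X + _]mul1r -mulrDl -ltr_pdivrMr // addrC.
  by move: nhi; rewrite intrD.
have ab1 : a * b ^ (- n) = 1.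
  apply/eqP; rewrite eq_le c1 andbT leNgt; apply/negP => c_gt.
  have := bmin _ _ (subgroupM Ggrp GA (subgroupXz _ Ggrp GB)) dAB c_gt.
  by rewrite leNgt cb.
have AB1 : A * B ^ (- n) = 1.
  by apply: diagonal_inj diagonal1; rewrite -ab1.
by rewrite -[LHS]mulr1 -[1](expr0z B) -(addNr n) exprzDr // mulrA AB1 mul1r.
Qed.

End DiagonalAntidiagonal.

(** * Classification of groups of diagonal and antidiagonal matrices *)

Section Classification.
Variables (R : realType) (u v : 'cV[R]_2) (G : set 'M[int]_2).
Hypotheses (uv : cross u v != 0) (Ggrp : subgroup_GL2Z G).
Hypothesis Gdiag : forall A, G A ->
  (exists a, diagonal u v A a) \/ (exists a, antidiagonal u v A a).

Let G1 : G 1. Proof. by case: Ggrp. Qed.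

(** The square is diagonal with eigenvalue a/a = 1. *)
Lemma antidiagonal_involution A a : antidiagonal u v A a -> A * A = 1.
Proof.
move=> sA; apply: (diagonal_inj uv) (diagonal1 u v).
have [a0 _ _] := sA; have := antidiagonalM sA sA.
by rewrite divff // gt_eqF.
Qed.

(** Both sides are antidiagonal with the same parameter a b^n, which determines the matrix. *)
Lemma antidiagonal_inverts A B a b : B \is a GRing.unit ->
  antidiagonal u v A a -> diagonal u v B b ->
  forall n : int, A * B ^ n = B ^ (- n) * A.
Proof.
move=> uB sA dB n; have [b0 _ _] := dB.
apply: (antidiagonal_inj uv).
  exact: antidiagonal_diagonalM sA (diagonalXz n uB dB).
have := diagonal_antidiagonalM (diagonalXz (- n) uB dB) sA.
by rewrite invr_expz opprK.
Qed.

Lemma diagonal_group_cyclic B b :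
  G B -> diagonal u v B b -> 1 < b ->
  (forall A, G A -> exists n : int, A = B ^ n) ->
  isomorphic_to G (fun m n : int => m + n) /\ G = generated [set B].
Proof.
move=> GB dB b1 GE; have uB := subgroup_unit Ggrp GB; split.
  exists (fun n => B ^ n); split.
  (* Distinct powers of [B] have distinct eigenvalues, since b > 1. *)
  - move=> m n e; apply: (@ieexprIz _ b); [lra|by rewrite gt_eqF|].
    apply: (diagonal_uniq uv) (diagonalXz _ uB dB) _.
    by rewrite e; exact: diagonalXz.
  - apply/seteqP; split => [_ [n _ <-]|A /GE[n ->]]; last by exists n.
    exact: subgroupXz.
  - by move=> m n; rewrite exprzDr.
apply: generated_eq => // [_ ->//|H Hgrp BH A /GE[n ->]].
by apply: subgroupXz => //; exact: BH.
Qed.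

Lemma switch_group_order2 A a : G A -> antidiagonal u v A a ->
  (forall B b, G B -> diagonal u v B b -> b = 1) ->
  isomorphic_to G (fun m n : 'Z_2 => m + n) /\ G = generated [set A].
Proof.
move=> GA sA triv; have AA := antidiagonal_involution sA.
have GE B : G B -> B = 1 \/ B = A.
  move=> GB; have [[b dB]|[b sB]] := Gdiag GB; [left|right].
    apply: (diagonal_inj uv) (diagonal1 u v).
    by rewrite -(triv _ _ GB dB).
  (* The product of two switches fixes the rays, hence is 1 here; as [A] is its own inverse, the
     switches coincide. *)
  have dBA := antidiagonalM sB sA.
  have BA : B * A = 1.
    apply: (diagonal_inj uv) (diagonal1 u v).
    by rewrite -(triv _ _ (subgroupM Ggrp GB GA) dBA).
  by rewrite -[B]mulr1 -AA mulrA BA mul1r.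
have A1 : A <> 1.
  move=> A1; move: sA; rewrite A1.
  exact: diagonal_not_antidiagonal (diagonal1 u v).
have Z2E (k : 'Z_2) : k = 0 \/ k = 1.
  by case: k => -[|[|//]] ?; [left|right]; apply/val_inj.
split.
  exists (fun k : 'Z_2 => if k == 0 then 1 else A); split.
  - move=> k l; have [->|->] := Z2E k; have [->|->] := Z2E l => //=.
    by move/esym/A1.
  - apply/seteqP; split => [_ [k _ <-]|B /GE[->|->]].
    + by case: ifP.
    + by exists 0.
    + by exists 1.
  - move=> k l; rewrite mulmxE; have [->|->] := Z2E k.
      by rewrite add0r mul1r.
    by have [->|->] := Z2E l; rewrite /= ?mulr1 ?AA.
apply: generated_eq => // [_ ->//|H [_ H1 _ _] AH B /GE[->//|->]].
exact: AH.
Qed.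

Lemma switch_group_dihedral A B a b :
  G A -> antidiagonal u v A a -> G B -> diagonal u v B b -> 1 < b ->
  (forall D d, G D -> diagonal u v D d -> exists n : int, D = B ^ n) ->
  isomorphic_to G dihedral_mul /\ G = generated [set A; B].
Proof.
move=> GA sA GB dB b1 cyc; have uB := subgroup_unit Ggrp GB.
have AA := antidiagonal_involution sA.
have sw := antidiagonal_inverts uB sA dB.
(* Normal form: a switch times [A] fixes both rays, so it is a power of [B], and multiplying by [A]
   again recovers the switch. *)
have GE D : G D -> exists n (c : bool), D = B ^ n * A ^+ c.
  move=> GD; have [[d dD]|[d sD]] := Gdiag GD.
    by have [n ->] := cyc _ _ GD dD; exists n, false; rewrite mulr1.
  have [n DA] := cyc _ _ (subgroupM Ggrp GD GA) (antidiagonalM sD sA).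
  by exists n, true; rewrite -DA -mulrA AA mulr1.
have dX n := diagonalXz n uB dB.
split.
  exists (fun p : int * bool => B ^ p.1 * A ^+ p.2); split.
  - have bI m n : B ^ m = B ^ n -> m = n.
      move=> e; apply: (@ieexprIz _ b); [lra|by rewrite gt_eqF|].
      by apply: (diagonal_uniq uv) (dX _) _; rewrite e.
    (* One side fixes the rays and the other switches them. *)
    have ne m n : B ^ m <> B ^ n * A.
      move=> e; apply: (diagonal_not_antidiagonal uv (dX m)).
      by rewrite e; exact: diagonal_antidiagonalM (dX n) sA.
    have uA := subgroup_unit Ggrp GA.
    move=> [m []] [n []] /=; rewrite ?expr0 ?expr1 ?mulr1.
    + by move=> /(mulIr uA)/bI ->.
    + by move=> /esym/ne.
    + by move=> /ne.
    + by move=> /bI ->.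
  - apply/seteqP; split => [_ [[n c] _ <-]|D /GE[n [c ->]]].
      apply: subgroupM => //; first exact: subgroupXz.
      exact: (subgroupXz (Posz c)).
    by exists (n, c).
  - move=> [m c] [n d]; rewrite mulmxE /dihedral_mul /= exprzDr //.
    (* Only when the first factor contains [A] must it be moved past B^n, which inverts that power
       and yields the sign in [dihedral_mul]. *)
    case: c => /=; last by rewrite expr0 mul1r mulr1 mulrA.
    rewrite expr1 mulN1r -!mulrA; congr (_ * _); rewrite mulrA sw -mulrA.
    by congr (_ * _); case: d; rewrite /= ?expr1 ?expr0 ?AA ?mulr1.
apply: generated_eq => // [D [->|->]//|H Hgrp SH D /GE[n [c ->]]].
apply: subgroupM => //; first by apply: subgroupXz => //; apply: SH; right.
by apply: (subgroupXz (Posz c)) => //; apply: SH; left.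
Qed.

(** The four cases record whether [G] has a nontrivial element fixing the rays and whether it has
    one switching them. *)
Lemma plane_group_classification :
  [\/ G = [set 1%:M],
      isomorphic_to G (fun a b : 'Z_2 => a + b) /\
      (exists A : 'M[int]_2, switches_rays A u v /\ G = generated [set A]),
      isomorphic_to G (fun a b : int => a + b) /\
      (exists A : 'M[int]_2,
         [/\ fixes_ray A u, fixes_ray A v & G = generated [set A]])
    | isomorphic_to G dihedral_mul /\
      (exists A B : 'M[int]_2,
         [/\ switches_rays A u v, fixes_ray B u, fixes_ray B v
           & G = generated [set A; B]])].
Proof.
have [hyp|nhyp] := pselect (exists A a, [/\ G A, diagonal u v A a & a != 1]).
  have [B [b [GB dB b1 cyc]]] := diagonal_cyclic uv Ggrp hyp.
  have [Bu Bv] := diagonal_fixes dB.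
  have [[A [a [GA sA]]]|nsw] :=
      pselect (exists A a, G A /\ antidiagonal u v A a).
    have [iso gen] := switch_group_dihedral GA sA GB dB b1 cyc.
    apply: Or44; split => //; exists A, B; split => //.
    exact: antidiagonal_switches sA.
  have GE A : G A -> exists n : int, A = B ^ n.
    move=> GA; have [[a dA]|[a sA]] := Gdiag GA; first exact: cyc dA.
    by case: nsw; exists A, a.
  have [iso gen] := diagonal_group_cyclic GB dB b1 GE.
  by apply: Or43; split => //; exists B.
have triv B b : G B -> diagonal u v B b -> b = 1.
  move=> GB dB; apply/eqP; apply: contra_notT nhyp => b1.
  by exists B, b.
have [[A [a [GA sA]]]|nsw] :=
    pselect (exists A a, G A /\ antidiagonal u v A a).
  have [iso gen] := switch_group_order2 GA sA triv.
  apply: Or42; split => //; exists A; split => //.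
  exact: antidiagonal_switches sA.
apply: Or41; apply/seteqP; split => [A GA|_ ->//].
have [[a dA]|[a sA]] := Gdiag GA; last by case: nsw; exists A, a.
apply: (diagonal_inj uv) (diagonal1 u v).
by rewrite -(triv _ _ GA dA).
Qed.

End Classification.

(** * From the cone to the classification, through the rays of its closure *)

Theorem theorem3p9 (R : realType) (C : set 'cV[R]_2)
  (C_cone : convex_cone C)
  (C_pointed : pointed_cone (closure C))
  (C_full : full_dimensional C) :
  exists u1 u2 : 'cV[R]_2,
    has_extreme_rays (closure C) u1 u2 /\
    [\/ cone_group C = [set 1%:M],
        isomorphic_to (cone_group C) (fun a b : 'Z_2 => a + b) /\
        (exists A : 'M[int]_2,
           switches_rays A u1 u2 /\ cone_group C = generated [set A]),
        isomorphic_to (cone_group C) (fun a b : int => a + b) /\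
        (exists A : 'M[int]_2,
           [/\ fixes_ray A u1, fixes_ray A u2
             & cone_group C = generated [set A]])
      | isomorphic_to (cone_group C) dihedral_mul /\
        (exists A B : 'M[int]_2,
           [/\ switches_rays A u1 u2, fixes_ray B u1, fixes_ray B u2
             & cone_group C = generated [set A; B]])].
Proof.
have full : full_dimensional (closure C).
  case: C_full => w iw; exists w; move: iw; apply: interiorS.
  exact: subset_closure.
have [u [v [uv clE]]] := pointed_cone_wedge (closure_convex_cone C_cone)
  C_pointed (@closed_closure _ C) full.
have rays : has_extreme_rays (closure C) u v.
  by rewrite clE; exact: wedge_has_extreme_rays.
exists u, v; split => //.
apply: (plane_group_classification uv (cone_group_subgroup C)) => A GA.
have [dA AC _] := GA; have uA := GL2Z_unit dA.
have clA := act_closure uA AC.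
have [ext_u ext_v _ only] := rays.
have detA : (\det A)%:~R != 0 :> R.
  by case: dA => ->; rewrite ?mulrNz mulr1z ?oppr_eq0 oner_eq0.
(* Each extreme ray goes to one of the two. Both going to the same one would make the left side
   vanish, while [\det A] and [cross u v] are nonzero. *)
have := act_cross A u v.
have [/ray_eqP[a a0 Au]|/ray_eqP[a a0 Au]] :=
    only _ (act_extreme_ray uA clA ext_u);
  have [/ray_eqP[b b0 Av]|/ray_eqP[b b0 Av]] :=
    only _ (act_extreme_ray uA clA ext_v).
- rewrite Au Av crossZl crossZr crossxx !mulr0 => /esym/eqP.
  by rewrite mulf_eq0 (negbTE uv) (negbTE detA).
- by left; exists a; exact: GL2Z_diagonal Au Av.
- by right; exists a; exact: GL2Z_antidiagonal Au Av.
- rewrite Au Av crossZl crossZr crossxx !mulr0 => /esym/eqP.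
  by rewrite mulf_eq0 (negbTE uv) (negbTE detA).
Qed.
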